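(* Let $v\in T_q$ be a vertex, and let $f$ be a function on $T_q$ that is $C^{v-w}$-horosummable for all vertices $w$ adjacent to $v$. Then $$ f(v)=\frac{q}{q+1}\int_{\partial T_q}\left[\sum_{i=0}^{\infty}(q+1)^i\big(\gamma_i(\infty)+q^\infty\gamma_i(-\infty)\big)\triangle^i f(t)\right]_v dt, $$ that is, $$ f(v)=\frac{q}{q+1}\lim_{n\to\infty}\sum_{i=0}^{n}\left((q+1)^i\big(\gamma_i(n)+q^n\gamma_i(-n)\big)\sum_{u\in S_n(v)}\frac{\triangle^i f(u)}{q^n}\right). $$
   Context: $T_q$ is the infinite homogeneous tree in which every vertex has $q+1$ neighbors, and $\partial T_q$ is its Martin boundary; $v\sim w$ means that $v,w$ are joined by an edge. The Laplace operator on functions on the vertices of $T_q$ is $\triangle f(v)=\frac{1}{q+1}\sum_{w\sim v}f(w)-f(v)$; $\triangle^i$ is its $i$-th iterate and $\triangle^0$ is the identity. $S_n(v)$ is the set of vertices at distance $n$ from $v$. For $v,w$ joined by an edge $e$, the maximal proper cone $C^{v-w}$ is the connected component of $T_q\setminus e$ containing $v$, and $C^{v-w}_n=C^{v-w}\cap S_n(v)$. Put $f(C^{v-w}_n)=\frac1{q^n}\sum_{u\in C^{v-w}_n}f(u)$. The function $f$ is $C^{v-w}$-horosummable if $\lim_{n\to\infty}q^nf(C^{v-w}_{2n})=0$. Integral over the whole boundary, taken with respect to the vertex $v$: for arbitrary functions $\lambda_i$ on the set of positive integers, $$\int_{\partial T_q}\Big[\sum_{i=0}^\infty\lambda_i(\infty)\triangle^if(t)\Big]_vdt=\lim_{n\to\infty}\Big(\sum_{i=0}^n\lambda_i(n)\sum_{u\in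 S_n(v)}\frac{\triangle^if(u)}{q^n}\Big).$$ The polynomials $\gamma_i$: for each $i\ge0$, $\gamma_i(n)=c_{i,i}n^i+\dots+c_{i,1}n+c_{i,0}$, where (for fixed $i$) the collection $(c_{i,i},\dots,c_{i,1},c_{i,0})$ is the solution of the linear system $$\sum_{m=0}^{i}j^m\big(1+(-1)^mq^j\big)c_{i,m}=\begin{cases}0,&0\le j\le i-1,\\1,&j=i,\end{cases}\qquad j=0,1,\dots,i,$$ with the convention $0^0=1$ (so the equation for $j=0$ has left-hand side $2c_{i,0}$).
   Formalization: The polynomial γ_0 is taken to be 1 (equation 2c_{0,0}=2) instead of 1/2, since with γ_0=1/2 the formula fails, e.g. for f(u)=r^{d(u,v)} with 1/q<r<q^{-1/2}; and q≥2 is assumed, since for q=1 the system defining γ_1 has no solution. *)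

(* Defs.v *)
From HB Require Import structures.
From mathcomp Require Import all_boot all_order all_algebra.
From mathcomp Require Import all_classical all_reals all_analysis.

Set Implicit Arguments.
Unset Strict Implicit.
Unset Printing Implicit Defensive.

Import Order.TTheory GRing.Theory Num.Theory.
Import numFieldNormedType.Exports.

Local Open Scope classical_set_scope.
Local Open Scope ring_scope.

Section Tree.
Variables (V : choiceType) (e : rel V).

(* [ucycle e c] also holds for sequences of size 2 (an edge run back and
   forth), whence the bound on the size. *)
Definition acyclic : Prop := forall c : seq V, (2 < size c)%N -> ~ ucycle e c.

Definition connected_graph : Prop :=
  forall u v : V, exists2 p : seq V, path e u p & last u p = v.

(* For q >= 1 such a graph is automatically infinite (if V is inhabited). *)
Definition homogeneous_tree (q : nat) : Prop :=
  [/\ symmetric e, irreflexive e, connected_graph, acyclic &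
      forall v : V, ([set w | e v w] #= `I_q.+1)%card].

Definition walk (u v : V) (n : nat) : Prop :=
  exists p : seq V, [/\ path e u p, last u p = v & size p = n].

Definition at_distance (u v : V) (n : nat) : Prop :=
  walk u v n /\ forall m : nat, walk u v m -> (n <= m)%N.

Definition sphere (v : V) (n : nat) : set V := [set u | at_distance v u n].

Definition delete_edge (v w : V) : rel V :=
  fun x y => e x y && ((x, y) \notin [:: (v, w); (w, v)]).

(* The cone C^{v-w}. *)
Definition cone (v w : V) : set V :=
  [set u | exists2 p : seq V, path (delete_edge v w) v p & last v p = u].

Definition cone_sphere (v w : V) (n : nat) : set V :=
  cone v w `&` sphere v n.

(* Real- and complex-valued functions are treated at once. The sums over sets
   below are finitely supported sums; the sets are finite in a homogeneous
   tree. *)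
Variables (K : numFieldType) (q : nat).
Implicit Type f : V -> K.

Definition laplace f : V -> K :=
  fun v => q.+1%:R^-1 * (\sum_(w \in [set w | e v w]) f w) - f v.

Definition cone_mean f (v w : V) (n : nat) : K :=
  (q%:R ^+ n)^-1 * \sum_(u \in cone_sphere v w n) f u.

Definition horosummable f (v w : V) : Prop :=
  (fun n : nat => q%:R ^+ n * cone_mean f v w n.*2) @ \oo --> (0 : K).

Definition boundary_partial (lam : nat -> nat -> K) f (v : V) (n : nat) : K :=
  \sum_(0 <= i < n.+1)
    lam i n * \sum_(u \in sphere v n) (iter i laplace f u / q%:R ^+ n).

Definition boundary_integral (lam : nat -> nat -> K) f (v : V) : K :=
  limn (boundary_partial lam f v).

End Tree.

Section Gamma.
Variables (K : numFieldType) (q : nat).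

(* Row j, column m; in row 0, [0 ^+ 0 = 1]. The matrix is invertible for
   q >= 2: if the polynomial P of degree at most i has its coefficients in the
   kernel, then g n = P(n) + q^n P(-n) vanishes for -i <= n <= i, and
   g (- n) = q^(-n) g n; as g satisfies the recurrence with characteristic
   polynomial (X - 1)^(i+1) (X - q)^(i+1), whose constant term is q^(i+1),
   one gets 2 g (i+1) = 0, hence g = 0 and P = 0. *)
Definition gamma_mx (i : nat) : 'M[K]_i.+1 :=
  \matrix_(j, m) (j%:R ^+ m * (1 + (-1) ^+ m * q%:R ^+ j)).

(* For i = 0 the single equation is 2 c_(0,0) = 2, i.e. gamma_0 = 1. The
   normalisation 2 c_(0,0) = 1 would halve the term i = 0 of the inversion
   formula, which then fails, e.g. for f u = r ^ dist(v, u) with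
   q^-1 < r < q^(-1/2). The systems are meant to make
   gamma_i(n) + q^n gamma_i(-n) the coefficient of L^i in the expansion of
   x^-n + q^n x^n in powers of L = q x + x^-1 - (q + 1); for n = 0 this
   expansion is 2 = 2 L^0. *)
Definition gamma_rhs (i : nat) : 'cV[K]_i.+1 :=
  \col_j (if j == i :> nat then (if i == 0%N then 2 else 1) else 0).

Definition gamma_coef (i : nat) : 'cV[K]_i.+1 :=
  invmx (gamma_mx i) *m gamma_rhs i.

Definition gamma (i : nat) : {poly K} :=
  \sum_(m < i.+1) gamma_coef i m 0 *: 'X^m.

(* The bracket (q+1)^i (gamma_i(oo) + q^oo gamma_i(-oo)), as a function of
   the integer n that replaces oo. *)
Definition inversion_weight (i n : nat) : K :=
  q.+1%:R ^+ i * ((gamma i).[n%:R] + q%:R ^+ n * (gamma i).[- n%:R]).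

End Gamma.

(* Main.v *)
Require Import Defs.
From HB Require Import structures.
From mathcomp Require Import all_boot all_order all_algebra.
From mathcomp Require Import all_classical all_reals all_analysis.
From mathcomp Require Import finmap ring zify.

Set Implicit Arguments.
Unset Strict Implicit.
Unset Printing Implicit Defensive.

Import Order.TTheory GRing.Theory Num.Theory.
Import numFieldNormedType.Exports.

Local Open Scope classical_set_scope.
Local Open Scope ring_scope.

(** Let L be the operator (q+1) times the Laplace operator and let a n be the
    sum of f over the sphere of radius n about v. A vertex at distance n.+1
    from v has one neighbour at distance n and q neighbours at distance n.+2,
    so summing L f over spheres turns a into a n.+1 + q * a n.-1 - (q+1) * a n.
    The centre v, with its q+1 neighbours, is the exception; giving a 0 the
    value (q+1)/q * f v instead of f v makes the rule hold for all n > 0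
    ([sphere_sum_rec]). The rule at n = 0 never matters: for i <= n the sum of
    L^i f over the sphere of radius n depends on no radius below n - i.

    So on sequences L acts as y + q y^-1 - (q+1), where y is the shift. As
    y and q y^-1 have product q, the n-th Dickson polynomial with parameter q,
    taken at their sum L + q + 1, equals y^n + q^n y^-n; applied at radius n
    it gives a (2n) + q^n a 0 ([dickson_sum]). The weights of the inversion
    formula are the coefficients of these polynomials ([gamma_dickson]).
    After division by q^n the partial sum of the formula is therefore
    (q+1)/q * f v + q^-n a (2n), and its last term tends to 0: each vertex
    other than v lies in exactly q of the q+1 cones at v, so that q * a (2n)
    is the sum over these cones of the sums in the definition of
    horosummability ([sum_cones]).

    To identify the weights, write t i n for the coefficient of degree i of
    the n-th polynomial. The Dickson recurrence reads
    t i.+1 (n+1) - (q+1) * t i.+1 n + q * t i.+1 (n-1) = t i n, and the operator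
    on the left lowers degrees of polynomials by one and is onto. By induction
    on i, t i n = P n + q^n P (-n) for some polynomial P of degree at most i
    ([dickson_quasi_poly]). The n-th polynomial has degree n and is monic for
    n > 0, so the coefficients of P solve the system that defines gamma_i; the
    same triangularity shows that the matrix of the system is invertible. *)

(** * Shifted Dickson polynomials and the inversion weights *)

Section Weights.
Variables (K : numFieldType) (q : nat).
Implicit Types P Q : {poly K}.

(** Two consecutive polynomials are computed at once because the recurrence has
    order two. *)
Fixpoint dickson_pair n : {poly K} * {poly K} :=
  if n is n'.+1 then
    let: (s, t) := dickson_pair n' in
    (t, ('X + q.+1%:R%:P) * t - q%:R *: s)
  else (2%:P, 'X + q.+1%:R%:P).

(** With Y = 'X + (q+1), this is the polynomial in Y that takes the value
    y^n + (q / y)^n at Y = y + q / y. *)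
Definition dickson n := (dickson_pair n).1.

Lemma dickson0 : dickson 0 = 2%:P. Proof. by []. Qed.

Lemma dickson1 : dickson 1 = 'X + q.+1%:R%:P. Proof. by []. Qed.

Lemma dicksonSS n :
  dickson n.+2 = ('X + q.+1%:R%:P) * dickson n.+1 - q%:R *: dickson n.
Proof. by rewrite /dickson /=; case: (dickson_pair n). Qed.

Lemma coef_dicksonSS n i :
  (dickson n.+2)`_i = (if i is i'.+1 then (dickson n.+1)`_i' else 0)
    + q.+1%:R * (dickson n.+1)`_i - q%:R * (dickson n)`_i.
Proof.
by rewrite dicksonSS mulrDl coefB coefD coefXM coefCM coefZ; case: i.
Qed.

Lemma coef_dickson_le n i : (n <= i)%N ->
  (dickson n)`_i = (n == i)%:R * (if i == 0%N then 2 else 1).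
Proof.
elim/ltn_ind: n i => -[|[|n]] IHn [|i] //= ni.
- by rewrite dickson0 coefC mul1r.
- by rewrite dickson0 coefC mul0r.
- rewrite dickson1 coefD coefX coefC addr0 mulr1.
  by case: i {ni}.
rewrite coef_dicksonSS !IHn //; try by lia.
have -> : (n.+1 == i.+1) = false by apply/ltn_eqF; lia.
have -> : (n == i.+1) = false by apply/ltn_eqF; lia.
case: i ni => // i _; rewrite eqSS /=; ring.
Qed.

(** Formally, L = y + q y^-1 - (q+1) with y the shift in the second index of A,
    and the polynomial of index n takes the value y^n + q^n y^-n at L. The bound
    n <= m keeps all indices natural. *)
Lemma dickson_sum (A : nat -> nat -> K) :
  (forall i m, A i.+1 m.+1 = A i m.+2 + q%:R * A i m - q.+1%:R * A i m.+1) ->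
  forall n m, (n <= m)%N ->
  \sum_(0 <= i < n.+1) (dickson n)`_i * A i m
    = A 0%N (m + n)%N + q%:R ^+ n * A 0%N (m - n)%N.
Proof.
move=> recA; elim/ltn_ind => -[|[|n]] IHn m nm.
- by rewrite big_nat1 dickson0 coefC addn0 subn0 expr0; ring.
- case: m nm => // m _; rewrite big_nat_recr //= big_nat1 dickson1 !coefD !coefX.
  by rewrite !coefC recA addn1 subn1 expr1 /=; ring.
case: m nm => // m nm.
have E1 := IHn n.+1 (ltnSn _) m.+2 (leqW (ltnW nm)).
have E2 := IHn n.+1 (ltnSn _) m nm.
have E3 := IHn n (ltnW (ltnSn _)) m.+1 (ltnW (ltnW nm)).
(* The sums are padded with zero coefficients to a common range. *)
pose s k l := \sum_(0 <= i < n.+3) (dickson k)`_i * A i l.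
have sE k l : (k <= n.+2)%N ->
    s k l = \sum_(0 <= i < k.+1) (dickson k)`_i * A i l.
  move=> kn; rewrite /s (big_cat_nat (n := k.+1)) //= [X in _ + X]big_nat.
  rewrite [X in _ + X]big1 ?addr0 //.
  by move=> i /andP[ki _]; rewrite coef_dickson_le ?(ltnW ki) // ltn_eqF ?mul0r.
have sS : \sum_(0 <= i < n.+3)
    (if i is i'.+1 then (dickson n.+1)`_i' else 0) * A i m.+1
    = s n.+1 m.+2 + q%:R * s n.+1 m - q.+1%:R * s n.+1 m.+1.
  rewrite big_nat_recl // mul0r add0r.
  rewrite !sE // !mulr_sumr -big_split -sumrB /=.
  by apply: eq_bigr => i _; rewrite recA; ring.
transitivity (s n.+1 m.+2 + q%:R * s n.+1 m - q%:R * s n m.+1).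
  transitivity ((s n.+1 m.+2 + q%:R * s n.+1 m - q.+1%:R * s n.+1 m.+1)
    + q.+1%:R * s n.+1 m.+1 - q%:R * s n m.+1); last by ring.
  rewrite -sS /s !mulr_sumr -big_split -sumrB /=.
  by apply: eq_bigr => i _; rewrite coef_dicksonSS; case: i => [|i]; ring.
rewrite !sE //; last exact: leqW.
rewrite E1 E2 E3 !addSn !addnS !subSS.
have -> : (m.+1 - n = (m - n).+1)%N by lia.
by rewrite !exprS; ring.
Qed.

(** The characteristic polynomial of this recurrence is (x - 1) (x - q): the
    simple root 1 makes it lower degrees by exactly one, since q != 1. The
    symmetry n |-> -n exchanges the two roots, whence the companion solutions
    q^n P (-n). *)
Definition recurrence_op P : {poly K} :=
  P \Po ('X + 1) - q.+1%:R *: P + q%:R *: (P \Po ('X - 1)).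

Lemma recurrence_op_is_linear : linear recurrence_op.
Proof.
move=> c P Q; rewrite /recurrence_op !comp_polyD !comp_polyZ.
by rewrite -!mul_polyC; ring.
Qed.

HB.instance Definition _ :=
  GRing.isLinear.Build K {poly K} {poly K} _ recurrence_op
    recurrence_op_is_linear.

Lemma horner_recurrence_op P x :
  (recurrence_op P).[x] = P.[x + 1] - q.+1%:R * P.[x] + q%:R * P.[x - 1].
Proof. by rewrite /recurrence_op !hornerE !horner_comp !hornerE. Qed.

Lemma coef_shiftXn (c : K) m k :
  (('X + c%:P) ^+ m : {poly K})`_k = c ^+ (m - k) * 'C(m, k)%:R.
Proof.
rewrite addrC exprDn coef_sum.
under eq_bigr => i _ do
  rewrite -polyC_exp coefMn coefCM coefXn mulr_natr mulrb eq_sym.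
have [km|mk] := leqP k m.
  rewrite (bigD1 (Ordinal (km : k < m.+1)%N)) //= eqxx big1 ?addr0 ?mulr_natr //.
  by move=> i; rewrite -val_eqE /= => /negPf ->; rewrite mul0rn.
rewrite bin_small // mulr0 big1 // => i _.
by rewrite ltn_eqF ?mul0rn // (leq_ltn_trans _ mk) // -ltnS.
Qed.

Lemma coef_recurrence_opXn m k : (m <= k.+1)%N ->
  (recurrence_op 'X^m)`_k = (m == k.+1)%:R * (m%:R * (1 - q%:R)).
Proof.
move=> mk; rewrite /recurrence_op !comp_Xn_poly coefD coefB !coefZ coefXn.
rewrite -(polyC1 K) -polyCN !coef_shiftXn.
have [->|mk1] := eqVneq m k.+1.
  by rewrite subSnn binSn ltn_eqF // !expr1 !mul1r !mulr0 subr0; ring.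
have {mk1}mk : (m <= k)%N by rewrite -ltnS ltn_neqAle mk1.
have -> : (m - k = 0)%N by apply/eqP; rewrite subn_eq0.
rewrite !expr0 !mul1r mul0r; have [->|nkm] := eqVneq k m.
  by rewrite binn mulr1 -natr1; ring.
by rewrite bin_small ?ltn_neqAle ?mk 1?eq_sym ?nkm // !mulr0 subr0 addr0.
Qed.

Hypothesis q_gt1 : (1 < q)%N.

(** The leading term of the image of 'X^m is m * (1 - q) * 'X^m.-1, so leading
    terms are removed one after the other. Constants are in the kernel, which
    leaves Q.[0] free. *)
Lemma recurrence_op_onto n P : (size P <= n)%N ->
  exists Q, [/\ (size Q <= n.+1)%N, Q.[0] = 0 & recurrence_op Q = P].
Proof.
elim: n P => [|n IHn] P szP.
  move: szP; rewrite leqn0 size_poly_eq0 => /eqP ->.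
  by exists 0; rewrite size_poly0 horner0 linear0.
have lead_neq0 : n.+1%:R * (1 - q%:R) != 0 :> K.
  by rewrite mulf_neq0 ?pnatr_eq0 // subr_eq0 eq_sym pnatr_eq1 gtn_eqF.
pose c := P`_n / (n.+1%:R * (1 - q%:R)).
(* Subtracting the preimage of the leading term lowers the degree. *)
have szR : (size (P - recurrence_op (c *: 'X^(n.+1)))%R <= n)%N.
  apply/leq_sizeP => j nj; rewrite coefB linearZ coefZ coef_recurrence_opXn //.
  rewrite eqSS; have [<-|njN] := eqVneq n j; first by rewrite mul1r divfK ?subrr.
  rewrite mul0r mulr0 subr0; apply/(leq_sizeP _ _ szP).
  by rewrite ltn_neqAle njN.
have [Q [szQ Q0 opQ]] := IHn _ szR.
exists (Q + c *: 'X^(n.+1)); split.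
- rewrite (leq_trans (size_polyD _ _)) // geq_max (leq_trans szQ) //=.
  by rewrite (leq_trans (size_scale_leq _ _)) // size_polyXn.
- by rewrite !hornerE Q0 expr0n /= mulr0 addr0.
- by rewrite linearD /= opQ subrK.
Qed.

(** For a quasi-polynomial s n = P n + q^n P (-n), the recurrence extends to
    negative n with q^n s (-n) = s n. At n = 0 it then gives
    2 * s 1 = (q+1) * s 0 + the right-hand side at 0, so that s 1 is determined
    by s 0 and only the value at n = 0 has to be adjusted. *)
Lemma dickson_quasi_poly i :
  exists P : {poly K}, (size P <= i.+1)%N /\
    forall n, (dickson n)`_i = P.[n%:R] + q%:R ^+ n * P.[- n%:R].
Proof.
elim: i => [|i [P [szP PE]]].
  exists 1; split=> [|n]; first by rewrite size_poly1.
  rewrite !hornerE; elim/ltn_ind: n => -[|[|n]] IHn.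
  - by rewrite dickson0 coefC.
  - by rewrite dickson1 coefD coefX coefC add0r expr1 -natr1 addrC.
  rewrite coef_dicksonSS !IHn ?exprS //; last by ring.
have [Q [szQ Q0 opQ]] := recurrence_op_onto szP.
have opQE x : P.[x] = Q.[x + 1] - q.+1%:R * Q.[x] + q%:R * Q.[x - 1].
  by rewrite -opQ horner_recurrence_op.
exists Q; split=> // n; elim/ltn_ind: n => -[|[|n]] IHn.
- by rewrite dickson0 coefC oppr0 Q0 mulr0 addr0.
- have := PE 0%N; rewrite oppr0 expr0 mul1r opQE Q0 add0r sub0r.
  rewrite dickson0 dickson1 coefD coefX !coefC expr1 eqSS addr0 => E.
  (* E is the identity P.[0] + P.[0] = (dickson 0)`_i, that is, the recurrence
     at n = 0 for the quasi-polynomial built from Q. *)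
  apply: (mulfI (x := 2)); first by rewrite pnatr_eq0.
  transitivity (if i == 0%N then 2 else 0 : K).
    by case: (i == 0%N); rewrite ?mulr1 ?mulr0.
  by rewrite E; ring.
rewrite coef_dicksonSS PE !IHn // !opQE.
have -> : n.+1%:R + 1 = n.+2%:R :> K by rewrite natr1.
have -> : n.+1%:R - 1 = n%:R :> K by rewrite -natr1 addrK.
have -> : - n.+1%:R + 1 = - n%:R :> K by rewrite -natr1; ring.
have -> : - n.+1%:R - 1 = - n.+2%:R :> K by rewrite -[n.+2%:R]natr1; ring.
by rewrite !exprS; ring.
Qed.

Lemma gamma_mx_mulE i (P : {poly K}) (j : 'I_i.+1) : (size P <= i.+1)%N ->
  (gamma_mx K q i *m \col_(m < i.+1) P`_m) j 0
    = P.[j%:R] + q%:R ^+ j * P.[- j%:R].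
Proof.
move=> szP; rewrite mxE !(horner_coef_wide _ szP) mulr_sumr -big_split /=.
by apply: eq_bigr => m _; rewrite !mxE [in RHS]exprNn; ring.
Qed.

(** The columns of coefficients of the polynomials P_0, ..., P_i given by
    [dickson_quasi_poly] are mapped to a lower triangular matrix with diagonal
    entries 2, 1, ..., 1. *)
Lemma gamma_mx_unit i : gamma_mx K q i \in unitmx.
Proof.
have [P /all_and2[szP PE]] := choice dickson_quasi_poly.
pose C := \matrix_(m < i.+1, k < i.+1) (P k)`_m.
have MC (j k : 'I_i.+1) : (gamma_mx K q i *m C) j k = (dickson j)`_k.
  have szPi : (size (P k) <= i.+1)%N := leq_trans (szP k) (ltn_ord k).
  rewrite PE -(gamma_mx_mulE j szPi) !mxE.
  by apply: eq_bigr => m _; rewrite !mxE.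
have : gamma_mx K q i *m C \in unitmx.
  rewrite unitmxE det_trig.
    rewrite unitfE; apply/prodf_neq0 => j _; rewrite MC coef_dickson_le // eqxx.
    by rewrite mul1r; case: ifP; rewrite ?oner_neq0 ?pnatr_eq0.
  apply/is_trig_mxP => j k jk.
  by rewrite MC coef_dickson_le ?(ltnW jk) // ltn_eqF ?mul0r.
by rewrite unitmx_mul => /andP[].
Qed.

Lemma gamma_dickson i n :
  (gamma K q i).[n%:R] + q%:R ^+ n * (gamma K q i).[- n%:R] = (dickson n)`_i.
Proof.
have [P [szP PE]] := dickson_quasi_poly i.
suff -> : gamma K q i = P by rewrite -PE.
have PC : gamma_coef K q i = \col_(m < i.+1) P`_m.
  rewrite /gamma_coef; apply: (canLR (mulKmx (gamma_mx_unit i))).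
  apply/colP => j; rewrite gamma_mx_mulE // -PE coef_dickson_le; last first.
    by rewrite -ltnS.
  by rewrite mxE; case: eqP => _; rewrite ?mul1r ?mul0r.
apply/polyP => m; rewrite /gamma coef_sum.
under eq_bigr => k _ do rewrite PC mxE coefZ coefXn.
have [mi|im] := ltnP m i.+1.
  rewrite (bigD1 (Ordinal mi)) //= eqxx mulr1 big1 ?addr0 // => k.
  by rewrite -val_eqE eq_sym /= => /negPf ->; rewrite mulr0.
rewrite big1 ?(leq_sizeP _ _ szP) // => k _.
by rewrite gtn_eqF ?mulr0 // (leq_trans (ltn_ord k)).
Qed.

End Weights.

(** * Geodesics in a tree *)

Section Geodesics.
Variables (V : choiceType) (e : rel V).
Hypotheses (e_sym : symmetric e) (e_irr : irreflexive e).
Hypotheses (e_conn : connected_graph e) (e_acyclic : acyclic e).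
Implicit Types (u v w : V) (p : seq V).

(** In a tree the simple paths are the shortest ones, see [sphereP]. *)
Definition geodesic v u p := [/\ path e v p, uniq (v :: p) & last v p = u].

(** If the first edges differed, following p1 until it first meets p2 and coming
    back along p2 would be a simple cycle; it has length at least 3
    because the meeting point is not the vertex after v on both paths. *)
Lemma acyclic_no_fork v p1 p2 :
    path e v p1 -> uniq (v :: p1) -> path e v p2 -> uniq (v :: p2) ->
  has (mem p2) p1 -> head v p1 = head v p2.
Proof.
move=> + + + + meet; case/split_find: meet => z s1 t1 /= z_p2.
case/path.splitP: z_p2 => s2 t2 s1_p2 path1 uniq1 path2 uniq2.
case: (altP (@nilP _ (s1 ++ s2))) => [|s12].
  by case: s1 s2 {path1 uniq1 path2 uniq2 s1_p2} => [[]|].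
case: (@e_acyclic (v :: rcons s1 z ++ rev s2)).
  by rewrite /= size_cat size_rcons size_rev !addSn !ltnS -size_cat lt0n.
move: path1 path2; rewrite !cat_path => /andP[path1 _] /andP[path2 _].
move: uniq1 uniq2; rewrite /= !cat_uniq !mem_cat !negb_or => uniq1 uniq2.
case/andP: uniq1 => /andP[v_s1 _] /andP[uniq1 _].
case/andP: uniq2 => /andP[v_s2 _] /andP[uniq2 _].
rewrite /ucycle /= rcons_cat -rev_cons cat_path path1 last_rcons /=.
have -> /= : path e z (rev (v :: s2)).
  have := rev_path e v (rcons s2 z); rewrite last_rcons belast_rcons => ->.
  by rewrite (eq_path (e' := e)) // => x y; rewrite e_sym.
rewrite mem_cat negb_or v_s1 mem_rev cat_uniq uniq1 rev_uniq /=.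
move: v_s2 uniq2; rewrite mem_rcons inE negb_or rcons_uniq => /andP[_ ->].
case/andP=> z_s2 ->; rewrite andbT; apply/hasPn => x /=.
rewrite mem_rev mem_rcons inE => x_s2; apply/norP; split.
  by apply: contraNneq z_s2 => <-.
apply: contra s1_p2 => x_s1; apply/hasP; exists x => //=.
by rewrite mem_cat mem_rcons inE x_s2 orbT.
Qed.

Lemma geodesic_unique v u p1 p2 :
  geodesic v u p1 -> geodesic v u p2 -> p1 = p2.
Proof.
elim: p1 v p2 => [|x p1 IHp] v [|y p2] //.
all: move=> [path1 uniq1 last1] [path2 uniq2 last2].
- case/negP: (proj1 (andP uniq2)); move: last2 => /=.
  by rewrite -last1 /= => <-; rewrite mem_last.
- case/negP: (proj1 (andP uniq1)); move: last1 => /=.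
  by rewrite -last2 /= => <-; rewrite mem_last.
have /= xy : head v (x :: p1) = head v (y :: p2).
  apply: (@acyclic_no_fork v) => //; apply/hasP; exists u.
    by rewrite -last1 /= mem_last.
  by rewrite /= -last2 /= mem_last.
rewrite -xy in path2 uniq2 last2 *; congr (_ :: _); apply: (IHp x).
  by split; [case/andP: path1 | case/andP: uniq1 | ].
by split; [case/andP: path2 | case/andP: uniq2 | ].
Qed.

Definition geo v u : seq V := xget [::] [set p | geodesic v u p].

Lemma geoP v u : geodesic v u (geo v u).
Proof.
apply: (@xgetPex _ [::] [set p | geodesic v u p]).
have [p path_p last_p] := e_conn v u; move: last_p.
by case/shortenP: path_p => p' path_p' uniq_p' _ last_p'; exists p'.
Qed.

Lemma geo_eq v u p : geodesic v u p -> geo v u = p.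
Proof. exact/geodesic_unique/geoP. Qed.

Lemma sphereP v n u : sphere e v n u <-> size (geo v u) = n.
Proof.
have min_walk m : walk e v u m -> (size (geo v u) <= m)%N.
  case=> p [path_p]; case/shortenP: path_p => p' path_p' uniq_p' sub last_p' <-.
  rewrite (geo_eq (And3 path_p' uniq_p' last_p')) uniq_leq_size //.
  by case/andP: uniq_p'.
have [path_g _ last_g] := geoP v u.
have walk_g : walk e v u (size (geo v u)) by exists (geo v u).
split=> [[/min_walk gn /(_ _ walk_g) ng]|<-]; last by split.
by apply/anti_leq; rewrite gn.
Qed.

Lemma geo_refl v : geo v v = [::].
Proof. exact: geo_eq. Qed.

(** The geodesic to w goes through u or the geodesic to u goes through w:
    either w is off the geodesic to u, which it then extends, or the part of
    that geodesic after w is the edge from w to u, by uniqueness. *)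
Lemma geo_adj v u w :
  e u w -> geo v w = rcons (geo v u) w \/ geo v u = rcons (geo v w) u.
Proof.
move=> euw; have [path_g uniq_g last_g] := geoP v u.
have [w_g|w_g] := boolP (w \in v :: geo v u); [right|left].
  case/splitPl: w_g path_g uniq_g last_g => p1 p2 last1.
  rewrite cat_path last_cat last1 -cat_cons cat_uniq => /andP[path1 path2].
  case/and3P=> uniq1 disj uniq2 last2; rewrite (@geo_eq v w p1) //.
  rewrite -cats1; congr (_ ++ _); apply: (@geodesic_unique w u).
    split=> //=; rewrite uniq2 andbT; apply: contra disj => w_p2.
    by apply/hasP; exists w => //=; rewrite -last1 mem_last.
  split=> //=; first by rewrite e_sym euw.
  by rewrite inE andbT; apply: contraTneq euw => ->; rewrite e_irr.
apply: geo_eq; split; last by rewrite last_rcons.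
  by rewrite rcons_path path_g last_g.
by rewrite -rcons_cons rcons_uniq w_g.
Qed.

Definition level v u := size (geo v u).

Lemma level_adj v u w :
  e u w -> level v w = (level v u).+1 \/ level v u = (level v w).+1.
Proof.
by rewrite /level; case/(geo_adj v) => ->; rewrite size_rcons; [left|right].
Qed.

Lemma level0 v u : level v u = 0%N -> u = v.
Proof.
by rewrite /level => /size0nil g0; have [_ _ <-] := geoP v u; rewrite g0.
Qed.

Lemma geo_parent v u w :
  e u w -> level v w = (level v u).+1 -> geo v w = rcons (geo v u) w.
Proof.
move=> euw lev; case: (geo_adj v euw) => // g_u.
by move: lev; rewrite /level g_u size_rcons; lia.
Qed.

Lemma parent_exists v w n :
  level v w = n.+1 -> exists2 u, e u w & level v u = n.
Proof.
rewrite /level; have [] := geoP v w; case/lastP: (geo v w) => // p x.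
rewrite rcons_path last_rcons -rcons_cons rcons_uniq size_rcons.
case/andP=> path_p ex /andP[_ uniq_p] <- [<-].
by exists (last v p); rewrite // (@geo_eq v (last v p) p).
Qed.

Lemma parent_unique v u1 u2 w : e u1 w -> e u2 w ->
  level v w = (level v u1).+1 -> level v w = (level v u2).+1 -> u1 = u2.
Proof.
move=> e1 e2 l1 l2; have [_ _ <-] := geoP v u1; have [_ _ <-] := geoP v u2.
have := geo_parent e1 l1; rewrite (geo_parent e2 l2) => /rcons_inj[] ->.
by [].
Qed.

(** A geodesic from v can use the edge between v and w only as its first
    edge. *)
Lemma cone_sphereP v w n u : e v w ->
  cone_sphere e v w n.+1 u <-> level v u = n.+1 /\ head v (geo v u) != w.
Proof.
move=> evw; split=> [[[p path_p last_p] /sphereP lev]|[lev hd]].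
  split=> //; case/shortenP: path_p last_p => p' path_p' uniq_p' _ last_p'.
  have gE : geo v u = p'.
    apply: geo_eq; split=> //.
    by apply: sub_path path_p' => x y /andP[].
  move: lev path_p'; rewrite gE; case: p' {uniq_p' last_p' gE} => //= y p' _.
  by case/andP=> /andP[_ + _]; apply: contraNneq => ->; rewrite inE eqxx.
split; last exact/sphereP.
have := geoP v u; move: lev hd; rewrite /level; case: (geo v u) => //= y p _ yw.
case=> /andP[evy path_p] /andP[v_p _] last_p; exists (y :: p) => //=.
apply/andP; split.
  rewrite /delete_edge evy /= !inE !xpair_eqE eqxx (negPf yw) /=.
  by apply: contraTN evw => /andP[/eqP <-]; rewrite e_irr.
apply: (sub_in_path (P := predC1 v)) path_p.
  move=> x z xv zv exz; rewrite /delete_edge exz !inE !xpair_eqE.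
  by rewrite (negPf xv) (negPf zv) andbF.
by apply/allP => x x_p /=; apply: contraNneq v_p => <-.
Qed.

End Geodesics.

(** * Sums over spheres and cones *)

Section SphereSums.
Variables (K : numFieldType) (V : choiceType) (e : rel V) (q : nat).
Hypothesis tree : homogeneous_tree e q.
Implicit Types (u v w : V) (F f : V -> K).

Let e_sym : symmetric e. Proof. by case: tree. Qed.
Let e_irr : irreflexive e. Proof. by case: tree. Qed.
Let e_conn : connected_graph e. Proof. by case: tree. Qed.
Let e_acyclic : acyclic e. Proof. by case: tree. Qed.

Let sphereP := sphereP e_sym e_conn e_acyclic.
Let level_adj := level_adj e_sym e_irr e_conn e_acyclic.
Let cone_sphereP := cone_sphereP e_sym e_irr e_conn e_acyclic.

Definition nbrs v : seq V := enum_fset (fset_set [set w | e v w]).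

Definition sphere_seq v n : seq V := enum_fset (fset_set (sphere e v n)).

Lemma finite_nbrs v : finite_set [set w | e v w].
Proof. by exists q.+1; case: tree. Qed.

Lemma mem_nbrs v w : (w \in nbrs v) = e v w.
Proof.
rewrite /nbrs in_fset_set; last exact: finite_nbrs.
by apply/idP/idP => [/set_mem|evw]; last exact/mem_set.
Qed.

Lemma size_nbrs v : size (nbrs v) = q.+1.
Proof. by apply: card_fset_set; case: tree. Qed.

Lemma sphere0 v : sphere e v 0 = [set v].
Proof.
apply/seteqP; split=> [u /sphereP /(level0 e_conn) //|_ ->].
by apply/sphereP; rewrite geo_refl.
Qed.

Lemma finite_sphere v n : finite_set (sphere e v n).
Proof.
elim: n => [|n IHn].
  by rewrite sphere0; exact: finite_set1.
apply: (sub_finite_set _ (bigcup_finite IHn (fun u _ => finite_nbrs u))).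
move=> w /sphereP lw.
have [u euw lu] := parent_exists e_sym e_conn e_acyclic lw.
by exists u => //; apply/sphereP.
Qed.

Lemma mem_sphere_seq v n u : (u \in sphere_seq v n) = (level e v u == n).
Proof.
rewrite /sphere_seq in_fset_set; last exact: finite_sphere.
by apply/idP/eqP => [/set_mem/sphereP|lev]; last exact/mem_set/sphereP.
Qed.

Lemma sum_sphere v n F :
  \sum_(u \in sphere e v n) F u = \sum_(u <- sphere_seq v n) F u.
Proof. exact/fsbig_finite/finite_sphere. Qed.

Lemma count_parents v w n :
  level e v w = n.+1 -> count (fun u => level e v u == n) (nbrs w) = 1%N.
Proof.
move=> lev; have [u euw lu] := parent_exists e_sym e_conn e_acyclic lev.
transitivity (count_mem u (nbrs w)); last first.
  by rewrite count_uniq_mem ?fset_uniq // mem_nbrs e_sym euw.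
apply: eq_in_count => x; rewrite mem_nbrs => ewx /=.
apply/eqP/eqP => [lx|-> //].
apply: (@parent_unique _ _ e_sym e_irr e_conn e_acyclic v x u w) => //.
- by rewrite e_sym.
- by rewrite lx.
- by rewrite lu.
Qed.

Lemma count_children v w :
  count (fun u => level e v u == (level e v w).+1) (nbrs w) =
  if level e v w == 0%N then q.+1 else q.
Proof.
have := size_nbrs w.
rewrite -(count_predC (fun u => level e v u == (level e v w).+1)).
have -> : count (predC (fun u => level e v u == (level e v w).+1)) (nbrs w)
    = count (fun u => (level e v u).+1 == level e v w) (nbrs w).
  apply: eq_in_count => u; rewrite mem_nbrs => ewu /=.
  have := level_adj v ewu; rewrite /level; lia.
case lev: (level e v w) => [|n] /=; first by rewrite count_pred0 addn0.
have := count_parents lev; under eq_count do rewrite -eqSS.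
by move=> -> /eqP; rewrite addn1 eqSS => /eqP.
Qed.

(** Double counting of the edges between the spheres of radii n and m. *)
Lemma sum_edges v n m F :
  \sum_(u <- sphere_seq v n) \sum_(w <- nbrs u | level e v w == m) F w
  = \sum_(w <- sphere_seq v m)
      F w *+ count (fun u => level e v u == n) (nbrs w).
Proof.
have perm_edges x k : perm_eq [seq y <- nbrs x | level e v y == k]
                              [seq y <- sphere_seq v k | e x y].
  apply: uniq_perm; rewrite ?filter_uniq ?fset_uniq // => y.
  by rewrite !mem_filter mem_nbrs mem_sphere_seq andbC.
under eq_bigr => u _ do
  rewrite -big_filter (perm_big _ (perm_edges u m)) big_filter.
rewrite (exchange_big_dep xpredT) //=; apply: eq_bigr => w _.
rewrite big_const_seq iter_addr_0; congr (_ *+ _).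
rewrite -[RHS]size_filter (perm_size (perm_edges w n)) size_filter.
by apply: eq_count => u; rewrite e_sym.
Qed.

Lemma sum_sphere_nbrs v n F :
  \sum_(u <- sphere_seq v n.+1) \sum_(w <- nbrs u) F w
  = \sum_(w <- sphere_seq v n.+2) F w
    + (if n == 0%N then q.+1 else q)%:R * \sum_(w <- sphere_seq v n) F w.
Proof.
have split_nbrs u : u \in sphere_seq v n.+1 -> \sum_(w <- nbrs u) F w
    = \sum_(w <- nbrs u | level e v w == n.+2) F w
      + \sum_(w <- nbrs u | level e v w == n) F w.
  rewrite mem_sphere_seq => /eqP lu.
  rewrite (bigID (fun w => level e v w == n.+2)).
  congr (_ + _); rewrite [LHS]big_seq_cond [RHS]big_seq_cond.
  apply: eq_bigl => w.
  case euw: (w \in nbrs u) => //=; move: euw; rewrite mem_nbrs => euw.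
  have := level_adj v euw.
  by move: lu; rewrite /level; lia.
rewrite (eq_big_seq _ split_nbrs) big_split /= !sum_edges; congr (_ + _).
  apply: eq_big_seq => w; rewrite mem_sphere_seq => /eqP lw.
  by rewrite count_parents.
rewrite mulr_sumr; apply: eq_big_seq => w; rewrite mem_sphere_seq => /eqP lw.
by rewrite -lw count_children mulr_natl.
Qed.

(** A vertex other than v is missed by a single cone, that of the neighbour w
    through which its geodesic starts. *)
Lemma sum_cones v n F :
  \sum_(w <- nbrs v) \sum_(u \in cone_sphere e v w n.+1) F u
  = q%:R * \sum_(u \in sphere e v n.+1) F u.
Proof.
have coneE w : w \in nbrs v -> \sum_(u \in cone_sphere e v w n.+1) F u
    = \sum_(u <- sphere_seq v n.+1 | head v (geo e v u) != w) F u.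
  rewrite mem_nbrs => evw; pose s :=
    [seq u <- sphere_seq v n.+1 | head v (geo e v u) != w].
  transitivity (\sum_(u \in [set` s]) F u); last first.
    by rewrite -fsbig_seq ?filter_uniq ?fset_uniq // big_filter.
  apply: eq_fsbigl; apply/seteqP; split=> u /=.
    case/(cone_sphereP _ _ evw) => lu hu.
    by rewrite mem_filter hu mem_sphere_seq; apply/eqP.
  rewrite mem_filter mem_sphere_seq => /andP[hu /eqP lu].
  exact/cone_sphereP.
rewrite (eq_big_seq _ coneE) sum_sphere (exchange_big_dep xpredT) //= mulr_sumr.
apply: eq_big_seq => u; rewrite mem_sphere_seq => /eqP lu.
rewrite big_const_seq iter_addr_0 mulr_natl; congr (_ *+ _).
have := size_nbrs v; rewrite -(count_predC (pred1 (head v (geo e v u)))).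
have -> : count (pred1 (head v (geo e v u))) (nbrs v) = 1%N.
  rewrite count_uniq_mem ?fset_uniq // mem_nbrs.
  have [] := geoP e_conn v u; move: lu; rewrite /level.
  by case: (geo e v u) => //= x p _ /andP[-> _].
rewrite add1n => -[<-]; apply: eq_count => w /=.
by rewrite eq_sym.
Qed.

(** The factor at n = 0 compensates for v having q+1 neighbours one step further
    away, where every other vertex has q. *)
Definition sphere_sum v f i n : K :=
  (if n == 0%N then q.+1%:R / q%:R else 1) *
  \sum_(u \in sphere e v n) q.+1%:R ^+ i * iter i (laplace e q) f u.

Lemma sphere_sum_rec v f : (0 < q)%N -> forall i n,
  sphere_sum v f i.+1 n.+1
    = sphere_sum v f i n.+2 + q%:R * sphere_sum v f i n
      - q.+1%:R * sphere_sum v f i n.+1.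
Proof.
move=> q_gt0 i n; rewrite /sphere_sum !sum_sphere /= !mul1r.
set g := iter i (laplace e q) f.
have q0 : q%:R != 0 :> K by rewrite pnatr_eq0 -lt0n.
have q10 : q.+1%:R != 0 :> K by rewrite pnatr_eq0.
have -> : \sum_(u <- sphere_seq v n.+1) q.+1%:R ^+ i.+1 * laplace e q g u
    = q.+1%:R ^+ i * \sum_(u <- sphere_seq v n.+1) \sum_(w <- nbrs u) g w
      - q.+1%:R * \sum_(u <- sphere_seq v n.+1) q.+1%:R ^+ i * g u.
  rewrite !mulr_sumr -sumrB; apply: eq_bigr => u _.
  rewrite /laplace fsbig_finite; last exact: finite_nbrs.
  by rewrite -/(nbrs u) exprSr; field.
rewrite sum_sphere_nbrs -!mulr_sumr.
case: n => [|n] /=; last by ring.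
by field.
Qed.

End SphereSums.

(** * The inversion formula *)

Theorem corollary2p3 (K : numFieldType) (V : choiceType) (e : rel V) (q : nat)
    (hq : (1 < q)%N) (hT : homogeneous_tree e q) (v : V) (f : V -> K)
    (hf : forall w : V, e v w -> horosummable e q f v w) :
  f v = q%:R / q.+1%:R * boundary_integral e q (inversion_weight K q) f v
  /\
  (fun n : nat => q%:R / q.+1%:R *
     \sum_(0 <= i < n.+1)
       (q.+1%:R ^+ i *
          ((gamma K q i).[n%:R] + q%:R ^+ n * (gamma K q i).[- n%:R]) *
        \sum_(u \in sphere e v n) (iter i (laplace e q) f u / q%:R ^+ n)))
    @ \oo --> f v.
Proof.
have q_gt0 : (0 < q)%N by exact: ltnW.
have q0 : q%:R != 0 :> K by rewrite pnatr_eq0 -lt0n.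
have q10 : q.+1%:R != 0 :> K by rewrite pnatr_eq0.
have center : sphere_sum e q v f 0 0 = q.+1%:R / q%:R * f v.
  by rewrite /sphere_sum (sphere0 hT) fsbig_set1 mul1r.
(* Radius 0 is avoided: there the sum over the sphere is f v, whereas the
   sequence to which the recurrence applies starts at (q+1)/q * f v. *)
have partialE n : boundary_partial e q (inversion_weight K q) f v n.+1
    = q.+1%:R / q%:R * f v
      + q%:R^-1 *
        \sum_(w <- nbrs e v) q%:R ^+ n.+1 * cone_mean e q f v w n.+1.*2.
  transitivity ((q%:R ^+ n.+1)^-1 *
      \sum_(0 <= i < n.+2) (dickson K q n.+1)`_i * sphere_sum e q v f i n.+1).
    rewrite /boundary_partial mulr_sumr; apply: eq_bigr => i _.
    rewrite /inversion_weight gamma_dickson // /sphere_sum /= mul1r.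
    rewrite !(sum_sphere hT) !mulr_sumr; apply: eq_bigr => u _; ring.
  rewrite (dickson_sum (sphere_sum_rec hT v f q_gt0)) // subnn center addnn.
  rewrite -mulr_sumr.
  have -> : \sum_(w <- nbrs e v) cone_mean e q f v w n.+1.*2
      = (q%:R ^+ n.+1.*2)^-1 * (q%:R * \sum_(u \in sphere e v n.+1.*2) f u).
    by rewrite -(sum_cones hT) mulr_sumr.
  rewrite /sphere_sum /= -addnn exprD mul1r.
  rewrite (eq_fsbigr f) => [|u _]; last by rewrite mul1r.
  by field; rewrite expf_neq0 ?q0.
have cvg_sum :
    (fun n => \sum_(w <- nbrs e v) q%:R ^+ n * cone_mean e q f v w n.*2)
    @ \oo --> (0 : K).
  have : {in nbrs e v, forall w, e v w} by move=> w; rewrite (mem_nbrs hT).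
  elim: (nbrs e v) => [|w s IHs] sv.
    under eq_fun do rewrite big_nil.
    exact: cvg_cst.
  have evw : e v w by apply: sv; exact: mem_head.
  have {}sv : {in s, forall w, e v w}.
    by move=> x xs; apply: sv; rewrite inE xs orbT.
  under eq_fun do rewrite big_cons.
  by have := cvgD (hf w evw) (IHs sv); rewrite addr0; apply.
have cvg_partial : boundary_partial e q (inversion_weight K q) f v @ \oo
    --> q.+1%:R / q%:R * f v.
  rewrite -cvg_shiftS.
  under eq_fun do rewrite partialE.
  move: cvg_sum; rewrite -cvg_shiftS => /(cvgMl_tmp (a := q%:R^-1)).
  by move=> /(cvgD (cvg_cst (q.+1%:R / q%:R * f v))); rewrite mulr0 addr0; apply.
have scaleK : q%:R / q.+1%:R * (q.+1%:R / q%:R * f v) = f v.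
  by rewrite !mulrA divfK // mulfV // mul1r.
split.
  by rewrite /boundary_integral (cvg_lim (@norm_hausdorff _ _) cvg_partial).
by rewrite -[f v]scaleK; apply: cvgMl_tmp; exact: cvg_partial.
Qed.
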